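(* Let $G$ be a feedforward ReLU network model with parameters $w$. The degrees of freedom $d_G(w)$ is at most the rank of the path Jacobian matrix $J(w)$. Equality holds if $\dim\big(\mathrm{Span}(\phi(x):x\in\mathbb R^{|V_{\rm in}|})\big)=|\Pi|$, i.e. when the dimension of the space spanned by the vectors $\phi(x)$ equals the total number of paths $|\Pi|$.
   Context: $G=(V,E)$ is a directed acyclic graph with input nodes $V_{\rm in}$ (no incoming edges) and output nodes $V_{\rm out}$ (no outgoing edges) and edge weights $w\in\mathbb R^{E}$. Input nodes output the coordinates $x[u]$ of the input $x\in\mathbb R^{|V_{\rm in}|}$; internal nodes apply $\max(\cdot,0)$ to the weighted sum of their inputs; output nodes output the weighted sum without nonlinearity. For $v\in V_{\rm out}$ let $\Pi(v)$ be the set of all directed paths from any input node to $v$ and $\Pi=\bigcup_{v\in V_{\rm out}}\Pi(v)$. Then $$f_w(x)[v]=\sum_{p\in\Pi(v)}g_p(x)\,\pi_p(w)\,x[\mathrm{head}(p)],$$ where $\mathrm{head}(p)$ is the first node of $p$, $g_p(x)=1$ if all ReLU units along $p$ are active on input $x$ and $0$ otherwise, and $\pi_p(w)=\prod_{e\in p}w_e$. The path Jacobian is $J(w)=(\partial\pi_p(w)/\partial w_e)_{p\in\Pi,e\in E}\in\mathbb R^{|\Pi|\times|E|}$, and $\phi(x)\in\mathbb R^{|\Pi|}$ has entries $g_p(x)\,x[\mathrm{head}(p)]$. The activations $g_p(x)$ are treated as constant under infinitesimal changes of $w$, so the Jacobian of the network has rows $$\frac{\partial f_w(x)[v]}{\partial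 w}=J_v(w)^\top\phi_v(x),$$ where $J_v(w)$, $\phi_v(x)$ are the submatrix/subvector of $J(w)$, $\phi(x)$ with rows indexed by $\Pi(v)$. The degrees of freedom of $G$ at $w$ is $$d_G(w)=\dim\,\mathrm{Span}\Big(\bigcup_{x\in\mathbb R^{|V_{\rm in}|}}\Big\{\frac{\partial f_w(x)[v]}{\partial w}:v\in V_{\rm out}\Big\}\Big).$$ *)

(* Defs.v *)
From HB Require Import structures.
From mathcomp Require Import all_boot all_order all_algebra.
From mathcomp Require Import all_classical all_reals all_analysis.
Import numFieldNormedType.Exports.
Import Order.TTheory GRing.Theory Num.Theory.

Set Implicit Arguments.
Unset Strict Implicit.
Unset Printing Implicit Defensive.

Local Open Scope classical_set_scope.
Local Open Scope ring_scope.

Section Span.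
Context {K : fieldType} {V : vectType K}.
Implicit Types (S : set V) (U W : {vspace V}).

Definition is_span S U :=
  S `<=` [set` U] /\ (forall W, S `<=` [set` W] -> (U <= W)%VS).

Lemma span_exists S : exists U, is_span S U.
Proof.
pose P k := `[< exists s : seq V, [set` s] `<=` S /\ \dim << s >> = k >].
have exP : exists k, P k.
  by exists 0%N; apply/asboolP; exists [::]; split=> //; rewrite span_nil dimv0.
have ubP k : P k -> (k <= \dim {:V})%N.
  by move=> /asboolP[s [_ <-]]; apply/dimvS/subvf.
case: (ex_maxnP exP ubP) => k /asboolP[s [sS sk]] kmax.
exists << s >>%VS; split=> [v Sv|W SW] /=; last first.
  by apply/span_subvP => v /sS /SW.
have sub : (<< s >> <= << v :: s >>)%VS by rewrite span_cons addvSr.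
have : (\dim << v :: s >> <= \dim << s >>)%N.
  rewrite sk; apply: kmax; apply/asboolP; exists (v :: s); split=> // u /=.
  by rewrite inE => /predU1P[->|/sS].
move=> le; have/eqP -> : (<< s >> == << v :: s >>)%VS by rewrite eqEdim sub.
by rewrite memv_span ?mem_head.
Qed.

(* The linear span of a possibly infinite set of vectors: the least subspace
   containing it; [0%VS] is a junk default, see [SpanP]. *)
Definition Span S : {vspace V} := xget 0%VS [set U | is_span S U].

Lemma SpanP S : is_span S (Span S).
Proof. by rewrite /Span; case: xgetP (span_exists S) => [//|nU [U /nU]]. Qed.

End Span.

Record dag := Dag {
  vertex :> finType;
  arc : rel vertex;
  dag_acyclic : forall c : seq vertex, cycle arc c -> c = [::] }.

Arguments arc {d}.

Section Graph.
Variable G : dag.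

Definition is_input (v : G) := [forall u : G, ~~ arc u v].
Definition is_output (v : G) := [forall u : G, ~~ arc v u].
Definition is_internal (v : G) := ~~ is_input v && ~~ is_output v.

Definition edge := {e : G * G | arc e.1 e.2}.
Definition input_node := {v : G | is_input v}.
Definition output_node := {v : G | is_output v}.

HB.instance Definition _ := Finite.on edge.
HB.instance Definition _ := Finite.on input_node.
HB.instance Definition _ := Finite.on output_node.

Definition src (e : edge) : G := (val e).1.
Definition dst (e : edge) : G := (val e).2.

(* Directed paths from an input node to an output node: a pair of the first
   node and the sequence of subsequent nodes. Bounding the length by [#|G|]
   makes this a finite type and excludes no path, see [dag_path_size]. *)
Definition iopath :=
  {p : input_node * #|G|.-bseq G |
    path arc (val p.1) p.2 && is_output (last (val p.1) p.2)}.

HB.instance Definition _ := Finite.on iopath.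

Definition path_head (p : iopath) : input_node := (val p).1.
Definition path_tail (p : iopath) : seq G := (val p).2.
Definition target (p : iopath) : G := last (val (path_head p)) (path_tail p).

(* The arcs of the walk that starts at [u] and continues through [s]. *)
Definition walk_arcs (u : G) (s : seq G) : seq (G * G) := zip (u :: s) s.
Definition edges (p : iopath) : {set edge} :=
  [set e : edge | val e \in walk_arcs (val (path_head p)) (path_tail p)]%SET.

Lemma dag_path_uniq (u : G) (s : seq G) : path arc u s -> uniq (u :: s).
Proof.
elim: s u => [//|v s IH] u /= /andP[uv vs]; have /= -> := IH _ vs.
rewrite andbT; apply/negP => uin.
have : path arc u (v :: s) by rewrite /= uv.
case/splitPr: uin => p1 p2; rewrite -cat_rcons cat_path => /andP[cyc _].
by have := @dag_acyclic G (u :: p1) cyc.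
Qed.

Lemma dag_path_size (u : G) (s : seq G) : path arc u s -> (size s < #|G|)%N.
Proof.
by move=> /dag_path_uniq us; have := max_card (mem (u :: s)); rewrite (card_uniqP us).
Qed.

Section Network.
Context {R : realType}.
Implicit Types (w : edge -> R) (x : input_node -> R) (v : G) (p : iopath).

(* Forward evaluation, by recursion on a bound on the number of nodes on the
   walks ending at [v]; [#|G|] steps suffice, see [node_outE]. *)
Fixpoint node_out_rec (n : nat) w x v : R :=
  if n is n'.+1 then
    if insub v is Some u then x u
    else let z := \sum_(e : edge | dst e == v)
                    w e * node_out_rec n' w x (src e) in
         if is_output v then z else Num.max z 0
  else 0.

Definition node_out w x v : R := node_out_rec #|G| w x v.

Definition preact w x v : R :=
  \sum_(e : edge | dst e == v) w e * node_out w x (src e).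

Definition net_out w x (v : output_node) : R := node_out w x (val v).

(* A unit with zero pre-activation counts as inactive. *)
Definition active w x v : bool := 0 < preact w x v.

Definition gate w x p : R :=
  (all (fun v => is_internal v ==> active w x v)
       (val (path_head p) :: path_tail p))%:R.

Definition path_prod p w : R := \prod_(e in edges p) w e.

(* The network with its activations prescribed to be [g]. *)
Definition gated_out (g : iopath -> R) w x (v : output_node) : R :=
  \sum_(p : iopath | target p == val v) g p * path_prod p w * x (path_head p).

Definition partial (F : (edge -> R) -> R) w (e : edge) : R :=
  derive1 (fun t : R => F [eta w with e |-> t]) (w e).

Definition path_jacobian w : 'M[R]_(#|{: iopath}|, #|{: edge}|) :=
  \matrix_(i, j) partial (path_prod (enum_val i)) w (enum_val j).

Definition phi w x : 'rV[R]_#|{: iopath}| :=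
  \row_i (gate w x (enum_val i) * x (path_head (enum_val i))).

(* The gradient in the weights of the output at [v], where the activations are
   held fixed at their values at [w]; [net_outE] says that these gated outputs
   agree with the network at [w]. *)
Definition net_grad w x (v : output_node) : 'rV[R]_#|{: edge}| :=
  \row_j partial (fun w' => gated_out (gate w x) w' x v) w (enum_val j).

Definition dof w : nat :=
  \dim (Span (\bigcup_(x in [set: input_node -> R])
                [set net_grad w x v | v in [set: output_node]])).

Lemma node_out_rec_stable w x v n :
  (forall u s, path arc u s -> last u s = v -> (size s < n)%N) ->
  node_out_rec n.+1 w x v = node_out_rec n w x v.
Proof.
elim: n v => [|n IH] v H; first by have := H v [::] isT erefl.
pose z m := \sum_(e : edge | dst e == v) w e * node_out_rec m w x (src e).
have E m : node_out_rec m.+1 w x v =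
  if insub v is Some u then x u
  else if is_output v then z m else Num.max (z m) 0 by [].
rewrite !{}E; suff -> : z n.+1 = z n by [].
apply: eq_bigr => e /eqP ev; congr (_ * _); apply: IH => u s us ls.
have := H u (rcons s v); rewrite rcons_path us size_rcons last_rcons ls.
by apply=> //=; rewrite -ev; exact: (valP e).
Qed.

Lemma node_outE w x v :
  node_out w x v =
    if insub v is Some u then x u
    else if is_output v then preact w x v else Num.max (preact w x v) 0.
Proof.
by rewrite {1}/node_out -node_out_rec_stable // => u s /dag_path_size.
Qed.

(* All the walks with at most [n] nodes from an input node to [v]. *)
Fixpoint walks n v : seq (input_node * seq G) :=
  if n is n'.+1 then
    if insub v is Some u then [:: (u, [::])]
    else [seq (q.1, rcons q.2 v) |
            q <- flatten [seq walks n' (src e) | e <- enum {: edge} & dst e == v]]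
  else [::].

Lemma mem_walks n v u s :
  ((u, s) \in walks n v) =
  [&& (size s < n)%N, path arc (val u) s & last (val u) s == v].
Proof.
elim: n v u s => [//|n IH] v u s.
rewrite /=; case: insubP => [i iv <-|iv].
  rewrite inE; apply/idP/idP; first by case/eqP=> -> -> /=.
  case/and3P=> _ us /eqP; elim/last_ind: s us => [|s y _] us /=.
    by move=> /val_inj ->.
  rewrite last_rcons => yi; move: us; rewrite rcons_path yi => /andP[_].
  by rewrite (negbTE (forallP (valP i) _)).
apply/mapP/idP => [[[u' s'] /flatten_mapP[e]]|].
  rewrite mem_filter => /andP[/eqP ev _]; rewrite IH => /and3P[ss ps ls] [-> ->].
  rewrite size_rcons ltnS ss rcons_path ps last_rcons eqxx andbT /= (eqP ls).
  by rewrite -ev; exact: (valP e).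
case/and3P; elim/last_ind: s => [_ _ /= /eqP uv|s y _].
  by rewrite -uv (valP u) in iv.
rewrite size_rcons ltnS rcons_path last_rcons => ss /andP[us uy] /eqP yv.
exists (u, s); last by rewrite yv.
apply/flatten_mapP; rewrite yv in uy.
exists (exist _ (last (val u) s, v) uy : edge).
  by rewrite mem_filter mem_enum andbT /dst /=.
by rewrite IH ss us /src /=.
Qed.

Lemma walks_uniq n v : uniq (walks n v).
Proof.
elim: n v => [//|n IH] v /=; case: insubP => // _.
rewrite map_inj_uniq; last first.
  by move=> [a s] [b t] [-> /eqP]; rewrite eqseq_rcons eqxx andbT => /eqP ->.
have : uniq [seq e <- enum {: edge} | dst e == v].
  by rewrite filter_uniq ?enum_uniq.
have : all (fun e => dst e == v) [seq e <- enum {: edge} | dst e == v].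
  exact: filter_all.
elim: [seq e <- _ | _] => [//|e es IHe] /= /andP[ev esv] /andP[ees ues].
rewrite cat_uniq IH IHe // andbT /=; apply/hasPn => -[u s].
case/flatten_mapP => e' e'in; rewrite !mem_walks => /and3P[_ _ /eqP e's].
apply/negP => /and3P[_ _ /eqP es']; move/negP: ees; apply.
suff -> : e = e' by [].
apply/val_inj; move: (allP esv _ e'in) ev; rewrite /dst => /eqP d' /eqP d.
move: es' e's; rewrite /src; case: (val e) (val e') d d' => [a b] [a' b'] /=.
by move=> -> -> -> ->.
Qed.

Definition walk_term w x (q : input_node * seq G) : R :=
  (all (fun v => is_internal v ==> active w x v) (val q.1 :: q.2))%:R *
  (\prod_(e : edge | val e \in walk_arcs (val q.1) q.2) w e) * x q.1.

Lemma walk_arcs_rcons u s v :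
  walk_arcs u (rcons s v) = rcons (walk_arcs u s) (last u s, v).
Proof.
rewrite /walk_arcs; elim: s u => [//|y s IH] u /=.
by congr (_ :: _); exact: IH.
Qed.

Lemma node_out_walks w x v n :
  (forall u s, path arc u s -> last u s = v -> (size s < n)%N) ->
  node_out w x v = \sum_(q <- walks n v) walk_term w x q.
Proof.
elim: n v => [|n IH] v H; first by have := H v [::] isT erefl.
rewrite node_outE /=; case: insubP => [i iv vi|iv].
  rewrite big_seq1 /walk_term /= /is_internal (valP i) /= mul1r.
  by rewrite big_pred0 ?mul1r // => e; rewrite inE.
have -> : (if is_output v then preact w x v else Num.max (preact w x v) 0) =
    (is_internal v ==> active w x v)%:R * preact w x v.
  rewrite /is_internal iv /= /active; case: ifP => _ /=; first by rewrite mul1r.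
  by case: (ltP 0 (preact w x v)) => _; rewrite ?mul1r ?mul0r.
rewrite big_map big_flatten big_map big_filter big_enum_cond /= mulr_sumr.
apply: eq_big => // e /eqP ev; rewrite (IH (src e)); last first.
  move=> u s us ls.
  have := H u (rcons s v); rewrite rcons_path us size_rcons last_rcons ls.
  by apply=> //=; rewrite -ev; exact: (valP e).
rewrite !mulr_sumr; apply: eq_big_seq => -[u s].
rewrite mem_walks => /and3P[_ us /eqP ls].
rewrite /walk_term /= all_rcons.
have usv : path arc (val u) (rcons s v).
  by rewrite rcons_path us ls -ev; exact: (valP e).
have ein : val e = (last (val u) s, v).
  by rewrite ls -ev /src /dst; case: (val e).
have -> : \prod_(e0 : edge | val e0 \in walk_arcs (val u) (rcons s v)) w e0 =
    w e * \prod_(e0 : edge | val e0 \in walk_arcs (val u) s) w e0.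
  rewrite (bigD1 e) /=; last by rewrite walk_arcs_rcons mem_rcons inE ein eqxx.
  congr (_ * _); apply: eq_bigl => f.
  rewrite walk_arcs_rcons mem_rcons inE -ein (inj_eq val_inj).
  case: eqVneq => [->|_] /=; rewrite ?andbT // ein; apply/esym/negbTE/negP.
  move=> /(map_f snd) vin.
  have := dag_path_uniq usv; rewrite /= rcons_uniq => /and3P[_ /negP vs _].
  by apply: vs; rewrite -(@unzip2_zip _ _ (val u :: s) s) //= ltnW.
rewrite andbCA -!mulnb !natrM -!mulrA; congr (_ * _).
by rewrite mulrCA; congr (_ * _); rewrite mulrCA.
Qed.

Lemma net_outE w x (v : output_node) :
  net_out w x v = gated_out (gate w x) w x v.
Proof.
rewrite /net_out (@node_out_walks _ _ _ #|G|); last first.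
  by move=> u s /dag_path_size.
pose f (p : iopath) := (path_head p, path_tail p).
rewrite (perm_big [seq f p | p <- enum {: iopath} & target p == val v]).
  rewrite big_map big_filter big_enum_cond /=; apply: eq_bigr => p _.
  rewrite /walk_term /gate /path_prod /f /=.
  by congr (_ * _ * _); apply: eq_bigl => e; rewrite inE.
apply: uniq_perm; first exact: walks_uniq.
  rewrite map_inj_uniq ?filter_uniq -?enumT ?enum_uniq // => p p' [h t].
  apply/val_inj; move: h t; rewrite /path_head /path_tail.
  by case: (val p) (val p') => [a b] [a' b'] /= -> /val_inj ->.
move=> [u s]; rewrite mem_walks; apply/idP/mapP => [/and3P[ss us /eqP ls]|].
  have ss' : (size s <= #|G|)%N := ltnW ss.
  have us' : path arc (val (u, Bseq ss').1) (u, Bseq ss').2 &&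
      is_output (last (val (u, Bseq ss').1) (u, Bseq ss').2).
    by rewrite /= us ls (valP v).
  exists (exist _ (u, Bseq ss') us' : iopath) => //.
  by rewrite mem_filter mem_enum andbT /target /path_head /path_tail /= ls.
case=> p; rewrite mem_filter => /andP[/eqP pv _] [-> ->].
have /andP[pp _] := valP p.
by rewrite -pv /target eqxx andbT pp (dag_path_size pp).
Qed.

End Network.
End Graph.

(* Main.v *)
(* With the activations held fixed, the gradient of the output at [v] is the
   row vector [phi_v(x) J], where [phi_v(x)] is [phi(x)] with the entries of the
   paths that do not end at [v] set to zero. So all gradients lie in the row
   space of [J]. Conversely, for fixed [v] the vectors [u] such that [u_v J] is
   in the span of the gradients form a subspace that contains every [phi(x)]; if
   the [phi(x)] span everything, it contains the unit vector of each path ending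
   at [v], which is mapped to the corresponding row of [J]. *)
From HB Require Import structures.
Require Import Defs.
From mathcomp Require Import all_boot all_order all_algebra.
From mathcomp Require Import all_classical all_reals all_analysis.
Import numFieldNormedType.Exports.
Import GRing.Theory.

Local Open Scope classical_set_scope.
Local Open Scope ring_scope.

(** Links [\rank] to [\dim]: the rows of [row_base A], unlike those of [A], form a free family with
    [\rank A] members. *)
Definition rowspace {K : fieldType} {m n} (A : 'M[K]_(m, n)) :
  {vspace 'rV[K]_n} := << [tuple row i (row_base A) | i < \rank A] >>%VS.

Lemma mem_rowspace {K : fieldType} {m n} (A : 'M[K]_(m, n)) (u : 'rV[K]_n) :
  (u \in rowspace A) = (u <= A)%MS.
Proof.
rewrite -(eq_row_base A); apply/idP/idP => [/coord_span -> |/submxP[c ->]].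
  apply: summx_sub => i _; apply: scalemx_sub.
  by rewrite -tnth_nth tnth_mktuple row_sub.
rewrite mulmx_sum_row; apply: memv_suml => i _; apply: memvZ.
by apply/memv_span/tnthP; exists i; rewrite tnth_mktuple.
Qed.

Lemma dim_rowspace {K : fieldType} {m n} (A : 'M[K]_(m, n)) :
  \dim (rowspace A) = \rank A.
Proof.
suff : free [tuple row i (row_base A) | i < \rank A].
  by rewrite /free size_tuple => /eqP.
apply/freeP => k k0 i.
have : \row_j k j *m row_base A = 0.
  rewrite mulmx_sum_row -[RHS]k0; apply: eq_bigr => j _.
  by rewrite mxE -tnth_nth tnth_mktuple.
move/eqP; rewrite mulmx_free_eq0 ?row_base_free // => /eqP/rowP/(_ i).
by rewrite !mxE.
Qed.

(** Path products and gated outputs are affine in each single weight, so no other derivative has to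
    be computed. *)
Lemma partial_affine {R : realType} {G : dag} (F : (edge G -> R) -> R) w e a b :
  (forall t, F [eta w with e |-> t] = a * t + b) -> partial F w e = a.
Proof.
move=> Fab; rewrite /partial (_ : (fun t => _) = fun t => a * t + b); last first.
  exact/funext.
rewrite derive1E; apply: derive_val.
have : is_derive (w e) 1 ((a *: @id R) + cst b) (a *: 1 + 0).
  exact: is_deriveD.
by rewrite addr0 /GRing.scale /= mulr1.
Qed.

(** [edges p] is a set, so each weight occurs at most once in the product. *)
Lemma path_prod_affine {R : realType} {G : dag} (p : iopath G)
    (w : edge G -> R) e :
  exists b, forall t,
    path_prod p [eta w with e |-> t] = partial (path_prod p) w e * t + b.
Proof.
(* Any slope will do: [partial_affine] identifies it with the partial derivative. *)
suff [a [b ab]] : exists a b, forall t,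
    path_prod p [eta w with e |-> t] = a * t + b.
  by exists b => t; rewrite (partial_affine _ _ _ _ _ ab) ab.
pose c := \prod_(f in edges p | f != e) w f.
have cE t : \prod_(f in edges p | f != e) [eta w with e |-> t] f = c.
  by apply: eq_bigr => f /andP[_ /negbTE /= ->].
case: (boolP (e \in edges p)) => ep.
  exists c, 0; move=> t.
  by rewrite /path_prod (bigD1 e) //= eqxx cE addr0 mulrC.
exists 0, (path_prod p w); move=> t.
rewrite mul0r add0r; apply: eq_bigr => f fp /=.
by case: eqVneq fp => // -> fp; rewrite fp in ep.
Qed.

(** Zero padding to full length lets [phi_v] multiply all of [J] instead of the submatrix [J_v]. *)
Definition restrict {R : realType} {G : dag} (v : output_node G)
    (u : 'rV[R]_#|{: iopath G}|) : 'rV[R]_#|{: iopath G}| :=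
  \row_i (u 0 i *+ (target (enum_val i) == val v)).

Fact restrict_is_linear (R : realType) (G : dag) (v : output_node G) :
  linear (@restrict R G v).
Proof. by move=> a u u'; apply/rowP => i; rewrite !mxE mulrnDl mulrnAr. Qed.

HB.instance Definition _ (R : realType) (G : dag) (v : output_node G) :=
  GRing.isLinear.Build R _ _ _ (@restrict R G v) (restrict_is_linear R G v).

(** The gates stay fixed, so the affine forms of the path products add up to one whose slope is the
    matrix entry. *)
Lemma net_gradE {R : realType} {G : dag} (w : edge G -> R) x v :
  net_grad w x v = restrict v (phi w x) *m path_jacobian w.
Proof.
apply/rowP => j; rewrite !mxE; set e := enum_val j.
have /choice[b bE] p := path_prod_affine p w e.
pose B := \sum_(p | target p == val v) gate w x p * b p * x (path_head p).
rewrite (partial_affine _ _ _ (\sum_(p | target p == val v)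
  gate w x p * x (path_head p) * partial (path_prod p) w e) B).
  rewrite big_mkcond (reindex _ (onW_bij _ (enum_val_bij {: iopath G}))) /=.
  apply: eq_bigr => i _; rewrite !mxE.
  by case: ifP => _; rewrite ?mul0r.
move=> t; rewrite /gated_out mulr_suml -big_split /=; apply: eq_bigr => p _.
rewrite bE mulrDr mulrDl; congr (_ + _).
by rewrite !mulrA [LHS]mulrAC; congr (_ * _); rewrite mulrAC.
Qed.

Theorem theorem32 (R : realType) (G : dag) (w : edge G -> R) :
  (dof w <= \rank (path_jacobian w))%N /\
  (\dim (Span [set phi w x | x in [set: input_node G -> R]])
     = #|{: iopath G}| ->
   dof w = \rank (path_jacobian w)).
Proof.
rewrite /dof -dim_rowspace; set S := \bigcup_(x in _) _.
set J := path_jacobian w.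
have SJ : (Span S <= rowspace J)%VS.
  apply: (SpanP S).2 => _ [x _ [v _ <-]] /=.
  by rewrite net_gradE mem_rowspace submxMl.
split=> [|dimphi]; first exact: dimvS.
apply/eqP; rewrite eqn_leq dimvS //=; apply: dimvS.
have memS v u : restrict v u *m J \in Span S.
  pose L : 'Hom('rV[R]_#|{: iopath G}|, 'rV[R]_#|{: edge G}|) :=
    linfun (mulmxr J \o restrict v).
  have -> : restrict v u *m J = L u by rewrite lfunE.
  rewrite memv_preim; set phis := [set phi w x | x in _] in dimphi.
  (* By minimality of [Span phis] only the vectors [phi w x] matter, and [L] maps each to the
     gradient at [v]. *)
  have phiL : (Span phis <= L @^-1: Span S)%VS.
    apply: (SpanP phis).2 => _ [x _ <-] /=.
    rewrite -memv_preim lfunE /= -net_gradE.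
    by apply: (SpanP S).1; exists x => //; exists v.
  apply: (subvP phiL); suff -> : Span phis = fullv by exact: memvf.
  by apply/eqP; rewrite eqEdim subvf dimvf dimphi /dim /= mul1n leqnn.
apply/subvP => z; rewrite mem_rowspace => /submxP[c ->].
rewrite mulmx_sum_row; apply: memv_suml => i _; apply: memvZ.
have /andP[_ out] := valP (enum_val i).
(* Row [i] of [J] is the image of the [i]-th unit vector, which restriction to the target of path
   [i] leaves unchanged. *)
rewrite rowE (_ : delta_mx 0 i = restrict (Sub (target (enum_val i)) out)
  (delta_mx 0 i)); first exact: memS.
apply/rowP => k; rewrite !mxE eqxx /=.
by case: eqVneq => [->|_]; rewrite ?eqxx ?mul0rn.
Qed.
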